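(* Let $n\ge 2$ and $1\le k\le n-1$, let $(L,[\cdot,\dots,\cdot],\varepsilon,\alpha)$ be an $n$-Hom-Lie color algebra and let $\xi_1,\dots,\xi_k\in L_e$ be such that $\alpha(\xi_i)=\xi_i$ for $i=1,\dots,k$. Define $\{x_1,\dots,x_{n-k}\}_k=[\xi_1,\dots,\xi_k,x_1,\dots,x_{n-k}]$. Then $L_k=(L,\{\cdot,\dots,\cdot\}_k,\varepsilon,\alpha)$ is an $(n-k)$-Hom-Lie color algebra.
   Context: $G$ is an abelian group with neutral element $e$ (operation written $+$), $\mathbb{K}$ is a field of characteristic different from 2. A $G$-graded linear space is $V=\bigoplus_{a\in G}V_a$ over $\mathbb{K}$; $\mathcal{H}(V)$ is its set of homogeneous elements; a linear map $f:V\to V'$ is even if $f(V_a)\subseteq V'_a$ for all $a$. A (skew-symmetric) bicharacter is a map $\varepsilon:G\times G\to\mathbb{K}^*$ with $\varepsilon(a,b)\varepsilon(b,a)=1$, $\varepsilon(a,b+c)=\varepsilon(a,b)\varepsilon(a,c)$, $\varepsilon(a+b,c)=\varepsilon(a,c)\varepsilon(b,c)$. For homogeneous $x,y$ one writes $\varepsilon(x,y)$ for $\varepsilon(\deg x,\deg y)$, and sums of homogeneous elements inside $\varepsilon$ denote sums of their degrees. For an integer $n\ge1$, an $n$-Hom-Lie color algebra $(L,[\cdot,\dots,\cdot],\varepsilon,\alpha)$ is a $G$-graded linear space $L$ with an $n$-linear map $[\cdot,\dots,\cdot]:L^n\to L$, a bicharacter $\varepsilon$ and an even linear map $\alpha:L\to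 L$ such that for all $x_i,y_j\in\mathcal{H}(L)$: (1) $[x_1,\dots,x_i,x_{i+1},\dots,x_n]=-\varepsilon(x_i,x_{i+1})[x_1,\dots,x_{i+1},x_i,\dots,x_n]$ for $1\le i\le n-1$; (2) $[\alpha(x_1),\dots,\alpha(x_{n-1}),[y_1,\dots,y_n]]=\sum_{i=1}^n\varepsilon(X,Y_i)[\alpha(y_1),\dots,\alpha(y_{i-1}),[x_1,\dots,x_{n-1},y_i],\alpha(y_{i+1}),\dots,\alpha(y_n)]$, where $X=x_1+\dots+x_{n-1}$, $Y_i=y_1+\dots+y_{i-1}$ (sums of degrees, $Y_1=e$). *)

(* Defs.v *)
From HB Require Import structures.
From mathcomp Require Import all_boot all_order all_fingroup all_algebra.

Set Implicit Arguments.
Unset Strict Implicit.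
Unset Printing Implicit Defensive.

Import GRing.Theory.
Local Open Scope ring_scope.

Section ColorAlgebra.
Variables (G : zmodType) (K : fieldType) (L : lmodType K).

(* L is the internal direct sum of the subspaces V a; no finiteness is assumed
   on L or on G, so an element of the direct sum is a sum over a finite
   duplicate-free list of degrees. *)
Record is_grading (V : G -> {pred L}) : Prop := IsGrading {
  grading_subspace : forall a, submod_closed (V a);
  grading_span : forall v : L, exists (s : seq G) (f : G -> L),
    [/\ uniq s, forall a, f a \in V a & v = \sum_(a <- s) f a];
  grading_indep : forall (s : seq G) (f : G -> L),
    uniq s -> (forall a, f a \in V a) -> \sum_(a <- s) f a = 0 ->
    forall a, a \in s -> f a = 0
}.

Record is_bicharacter (eps : G -> G -> K) : Prop := IsBicharacter {
  bichar_neq0 : forall a b, eps a b != 0;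
  bichar_skew : forall a b, eps a b * eps b a = 1;
  bichar_addr : forall a b c, eps a (b + c) = eps a b * eps a c;
  bichar_addl : forall a b c, eps (a + b) c = eps a c * eps b c
}.

Definition even_map (V : G -> {pred L}) (f : L -> L) : Prop :=
  forall a x, x \in V a -> f x \in V a.

Definition subst_tuple n (x : n.-tuple L) (i : 'I_n) (z : L) : n.-tuple L :=
  [tuple if j == i then z else tnth x j | j < n].

Definition swap_tuple n (x : n.-tuple L) (i j : 'I_n) : n.-tuple L :=
  [tuple tnth x (tperm i j l) | l < n].

(* (x_1, ..., x_(n-1), z) as an n-tuple *)
Definition snoc_tuple n (n_gt0 : (0 < n)%N) (x : n.-1.-tuple L) (z : L) :
    n.-tuple L :=
  tcast (prednK n_gt0) [tuple of rcons x z].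

Definition multilinear_map n (br : n.-tuple L -> L) : Prop :=
  forall (x : n.-tuple L) (i : 'I_n), linear (fun z => br (subst_tuple x i z)).

Definition homogeneous (V : G -> {pred L}) n (x : n.-tuple L) (d : 'I_n -> G) :
    Prop :=
  forall i, tnth x i \in V (d i).

Definition color_skew_symmetric (V : G -> {pred L}) (eps : G -> G -> K) n
    (br : n.-tuple L -> L) : Prop :=
  forall (x : n.-tuple L) (d : 'I_n -> G), homogeneous V x d ->
  forall i j : 'I_n, j = i.+1 :> nat ->
    br x = - (eps (d i) (d j) *: br (swap_tuple x i j)).

Definition n_hom_jacobi (V : G -> {pred L}) (eps : G -> G -> K)
    (alpha : L -> L) n (n_gt0 : (0 < n)%N) (br : n.-tuple L -> L) : Prop :=
  forall (x : n.-1.-tuple L) (dx : 'I_n.-1 -> G)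
         (y : n.-tuple L) (dy : 'I_n -> G),
  homogeneous V x dx -> homogeneous V y dy ->
    br (snoc_tuple n_gt0 (map_tuple alpha x) (br y)) =
    \sum_(i < n)
      eps (\sum_(j < n.-1) dx j) (\sum_(j < n | (j < i)%N) dy j) *:
        br (subst_tuple (map_tuple alpha y) i
              (br (snoc_tuple n_gt0 x (tnth y i)))).

(* The bracket is only required to be multilinear, not to be compatible with
   the grading. *)
Record n_hom_Lie_color_algebra (V : G -> {pred L}) n (br : n.-tuple L -> L)
    (eps : G -> G -> K) (alpha : {linear L -> L}) : Prop :=
    NHomLieColorAlgebra {
  nhlc_arity_gt0 : (0 < n)%N;
  nhlc_grading : is_grading V;
  nhlc_multilinear : multilinear_map br;
  nhlc_bicharacter : is_bicharacter eps;
  nhlc_even : even_map V alpha;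
  nhlc_skew : color_skew_symmetric V eps br;
  nhlc_jacobi : n_hom_jacobi V eps alpha nhlc_arity_gt0 br
}.

Definition partial_bracket n k (le_kn : (k <= n)%N) (br : n.-tuple L -> L)
    (xi : k.-tuple L) : (n - k).-tuple L -> L :=
  fun x => br (tcast (subnKC le_kn) [tuple of xi ++ x]).

End ColorAlgebra.

(* Main.v *)
(* Apply the n-ary identity to (xi, x) and (xi, y).  Since the xi_i have degree
   e and eps(e, _) = 1, the factors eps(X, Y_i) are unchanged by the prefix xi.
   The summands indexed by the prefix contain [xi, x, xi_i], where xi_i occurs
   twice; color skew-symmetry moves the copies side by side and gives v = - v,
   so these summands vanish as the characteristic is not 2. *)
Require Import Defs.
From HB Require Import structures.
From mathcomp Require Import all_boot all_order all_fingroup all_algebra.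

Set Implicit Arguments.
Unset Strict Implicit.
Unset Printing Implicit Defensive.

Import GRing.Theory.
Local Open Scope ring_scope.

Lemma addn_predr k m : (0 < m)%N -> (k + m.-1 = (k + m).-1)%N.
Proof. by case: m => // m _; rewrite addnS. Qed.

Section Bicharacter.
Variables (G : zmodType) (K : fieldType) (eps : G -> G -> K).
Hypothesis eps_bichar : is_bicharacter eps.

Lemma bichar0l b : eps 0 b = 1.
Proof.
have eps0_neq0 := bichar_neq0 eps_bichar 0 b.
apply: (mulfI eps0_neq0).
by rewrite -(bichar_addl eps_bichar) addr0 mulr1.
Qed.

End Bicharacter.

Section TupleConcatenation.
Variables (K : fieldType) (L : lmodType K) (k m : nat) (xi : k.-tuple L).

Lemma subst_cat_tuple (x : m.-tuple L) (i : 'I_m) z :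
  subst_tuple [tuple of xi ++ x] (rshift k i) z =
  [tuple of xi ++ subst_tuple x i z].
Proof.
apply: eq_from_tnth => l; rewrite tnth_mktuple.
case: (split_ordP l) => l' ->; rewrite ?tnth_lshift ?tnth_rshift.
  by rewrite eq_lrshift.
by rewrite tnth_mktuple eq_rshift.
Qed.

Lemma swap_cat_tuple (x : m.-tuple L) (i j : 'I_m) :
  swap_tuple [tuple of xi ++ x] (rshift k i) (rshift k j) =
  [tuple of xi ++ swap_tuple x i j].
Proof.
apply: eq_from_tnth => l; rewrite tnth_mktuple.
case: (split_ordP l) => l' ->.
  by rewrite tpermD ?eq_rlshift // !tnth_lshift.
by rewrite -(inj_tperm _ _ _ (@rshift_inj k m)) !tnth_rshift tnth_mktuple.
Qed.

End TupleConcatenation.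

Lemma val_snoc_tuple (K : fieldType) (L : lmodType K) n
    (n_gt0 : (0 < n)%N) (x : n.-1.-tuple L) z :
  snoc_tuple n_gt0 x z = rcons x z :> seq L.
Proof. by rewrite val_tcast. Qed.

Section Repetition.
Variables (G : zmodType) (K : fieldType) (L : lmodType K) (V : G -> {pred L}).
Variables (eps : G -> G -> K) (n : nat) (br : n.-tuple L -> L).
Hypothesis char_neq2 : 2%N \notin [pchar K].
Hypothesis br_skew : color_skew_symmetric V eps br.

Lemma homogeneous_swap (x : n.-tuple L) d i j :
  homogeneous V x d -> homogeneous V (swap_tuple x i j) (d \o tperm i j).
Proof. by move=> xd l; rewrite tnth_mktuple; apply: xd. Qed.

(** Adjacent transpositions carry the right-hand copy leftwards until it stands next to position
    [i]. The factors picked up are harmless because the target value is 0, and [eps a a = 1]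
    excludes the sign -1 that would make the last swap vacuous. *)
Lemma skew_repetition_eq0 (x : n.-tuple L) (d : 'I_n -> G) (i j : 'I_n) a :
  homogeneous V x d -> (i < j)%N -> tnth x i = tnth x j ->
  d i = a -> d j = a -> eps a a = 1 -> br x = 0.
Proof.
move=> + + + + + eps_aa.
(* Induction on a bound [b] for [j], with [x] and [d] generalized since each swap changes them. *)
move: {2}(j : nat) (leqnn j) => b; elim: b x d j => [|b IHb] x d j.
  by rewrite leqn0 => /eqP ->.
move=> le_jb xd lt_ij x_ij d_i d_j.
have [j_i | j_neq] := eqVneq (j : nat) i.+1.
  have := br_skew xd j_i; rewrite d_i d_j eps_aa scale1r.
  (* Exchanging two equal entries changes nothing, so skew-symmetry reads [br x = - br x]. *)
  have -> : swap_tuple x i j = x.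
    apply: eq_from_tnth => l; rewrite tnth_mktuple.
    by case: tpermP => [-> | -> | ].
  move/eqP; rewrite -addr_eq0 -mulr2n -scaler_nat scaler_eq0.
  by case/orP=> [two0 | /eqP //]; case/negP: char_neq2; rewrite inE /= two0.
have lt_i1j : (i.+1 < j)%N by rewrite ltn_neqAle eq_sym j_neq.
have j_gt0 : (0 < j)%N by apply: leq_trans lt_ij.
have lt_pj : (j.-1 < n)%N by apply: leq_ltn_trans (leq_pred _) (ltn_ord j).
pose p := Ordinal lt_pj.
have j_p : j = p.+1 :> nat by rewrite /= prednK.
have lt_ip : (i < p)%N by rewrite -ltnS -j_p.
have pi_neq : p != i by rewrite -val_eqE gtn_eqF.
have ji_neq : j != i by rewrite -val_eqE gtn_eqF.
(* After swapping [p] and [j] the second copy sits at [p], while position [i] is untouched. *)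
rewrite (br_skew xd j_p) (IHb _ (d \o tperm p j) p) ?scaler0 ?oppr0 //.
- by rewrite -ltnS -j_p.
- exact: homogeneous_swap.
- by rewrite !tnth_mktuple tpermL tpermD.
- by rewrite /= tpermD.
- by rewrite /= tpermL.
Qed.

End Repetition.

Lemma multilinear_map0 (K : fieldType) (L : lmodType K) n
    (br : n.-tuple L -> L) (x : n.-tuple L) i :
  multilinear_map br -> br (subst_tuple x i 0) = 0.
Proof.
(* Linearity at [-1 *: 0 + 0] expresses the value as its own negative plus itself. *)
by move=> /(_ x i (-1) 0 0); rewrite scaler0 addr0 scaleN1r addNr.
Qed.

Section PartialBracket.
Variables (G : zmodType) (K : fieldType) (L : lmodType K) (V : G -> {pred L}).
Variables (k m : nat) (br : (k + m).-tuple L -> L) (eps : G -> G -> K).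
Variables (alpha : {linear L -> L}) (xi : k.-tuple L).
Hypothesis char_neq2 : 2%N \notin [pchar K].
Hypothesis m_gt0 : (0 < m)%N.
Hypothesis HL : n_hom_Lie_color_algebra V br eps alpha.
Hypothesis xi_deg0 : forall i : 'I_k, tnth xi i \in V 0.
Hypothesis xi_fixed : forall i : 'I_k, alpha (tnth xi i) = tnth xi i.

(** Writing the arity as [k + m] lets [xi ++ x] be fed to [br] without a cast. *)
Let pbr (x : m.-tuple L) := br [tuple of xi ++ x].

Definition cat_degree p (d : 'I_p -> G) (i : 'I_(k + p)) : G :=
  if split i is inr j then d j else 0.

Lemma cat_degree_lshift p (d : 'I_p -> G) i : cat_degree d (lshift p i) = 0.
Proof. by rewrite /cat_degree (unsplitK (inl i)). Qed.

Lemma cat_degree_rshift p (d : 'I_p -> G) i : cat_degree d (rshift k i) = d i.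
Proof. by rewrite /cat_degree (unsplitK (inr i)). Qed.

Lemma homogeneous_cat p (x : p.-tuple L) d :
  homogeneous V x d -> homogeneous V [tuple of xi ++ x] (cat_degree d).
Proof.
move=> xd l; case: (split_ordP l) => l' ->.
  by rewrite tnth_lshift cat_degree_lshift.
by rewrite tnth_rshift cat_degree_rshift.
Qed.

(** The prefix contributes only zeros. The predicate [P] is arbitrary so as to cover both the full
    sum X and the partial sums Y_i. *)
Lemma sum_cat_degree p (d : 'I_p -> G) (P : pred 'I_(k + p)) :
  \sum_(j | P j) cat_degree d j = \sum_(j | P (rshift k j)) d j.
Proof.
rewrite big_split_ord /= big1 ?add0r => [|j _]; last exact: cat_degree_lshift.
by apply: eq_bigr => j _; apply: cat_degree_rshift.
Qed.

Lemma map_cat_fixed p (x : p.-tuple L) :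
  map_tuple alpha [tuple of xi ++ x] = [tuple of xi ++ map_tuple alpha x].
Proof.
apply: val_inj; rewrite /= map_cat; congr (_ ++ _).
have /(congr1 val)/= -> // : map_tuple alpha xi = xi.
by apply: eq_from_tnth => i; rewrite tnth_map xi_fixed.
Qed.

Lemma partial_multilinear : multilinear_map pbr.
Proof.
move=> x i a u v; rewrite /pbr -!subst_cat_tuple.
exact: (nhlc_multilinear HL).
Qed.

Lemma partial_skew : color_skew_symmetric V eps pbr.
Proof.
move=> x d xd i j j_i; rewrite /pbr -swap_cat_tuple.
rewrite (nhlc_skew HL (homogeneous_cat xd) (i := rshift k i) (j := rshift k j)).
  by rewrite !cat_degree_rshift.
by rewrite /= j_i addnS.
Qed.

(** The cast is needed because [(k + m).-1] and [k + m.-1] agree only when [m] is positive. *)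
Let xcat (x : m.-1.-tuple L) : (k + m).-1.-tuple L :=
  tcast (addn_predr k m_gt0) [tuple of xi ++ x].

Lemma homogeneous_tcast p q (e : p = q) (x : p.-tuple L) d :
  homogeneous V x d -> homogeneous V (tcast e x) (d \o cast_ord (esym e)).
Proof. by move=> xd i; rewrite tcastE; apply: xd. Qed.

Lemma snoc_cat_tuple (n_gt0 : (0 < k + m)%N) (x : m.-1.-tuple L) z :
  snoc_tuple n_gt0 (xcat x) z = [tuple of xi ++ snoc_tuple m_gt0 x z].
Proof.
by apply: val_inj; rewrite /= !val_snoc_tuple val_tcast /= rcons_cat.
Qed.

Lemma homogeneous_snoc (x : m.-1.-tuple L) d z b :
  homogeneous V x d -> z \in V b ->
  exists2 d', homogeneous V (snoc_tuple m_gt0 x z) d' &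
    forall l : 'I_m, l = m.-1 :> nat -> d' l = b.
Proof.
move=> xd zb.
(* [insub] succeeds exactly for [l < m.-1]; the last index falls through to the degree [b] of
   [z]. *)
exists (fun l : 'I_m => if insub (l : nat) is Some l' then d l' else b);
  last by move=> l l_m; rewrite insubN // l_m ltnn.
move=> l; rewrite (tnth_nth 0) val_snoc_tuple nth_rcons size_tuple.
case: insubP => [l' lt_l l'_l | ]; first by rewrite lt_l -l'_l -tnth_nth.
rewrite -leqNgt => le_l; rewrite ltnNge le_l /=.
(* The default 0 of [nth] is never reached: [m.-1 <= l < m] forces [l = m.-1]. *)
case: eqP => // -[]; apply/eqP.
by rewrite eqn_leq le_l andbT -ltnS prednK.
Qed.

(** The two copies stand at position [i] of the prefix and at the very end; both have degree 0, and
    [eps 0 0 = 1]. *)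
Lemma bracket_prefix_repetition (x : m.-1.-tuple L) d (i : 'I_k) :
  homogeneous V x d -> pbr (snoc_tuple m_gt0 x (tnth xi i)) = 0.
Proof.
move=> xd; have [d' xd' d'_last] := homogeneous_snoc xd (xi_deg0 i).
have lt_m : (m.-1 < m)%N by rewrite prednK.
pose l := Ordinal lt_m.
apply: (skew_repetition_eq0 char_neq2 (nhlc_skew HL) (homogeneous_cat xd')
  (i := lshift m i) (j := rshift k l) (a := 0)).
- by rewrite /= ltn_addr.
- rewrite tnth_lshift tnth_rshift [RHS](tnth_nth 0) val_snoc_tuple nth_rcons.
  by rewrite size_tuple /= ltnn eqxx.
- exact: cat_degree_lshift.
- by rewrite cat_degree_rshift d'_last.
- exact: bichar0l (nhlc_bicharacter HL) _.
Qed.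

Lemma partial_jacobi : n_hom_jacobi V eps alpha m_gt0 pbr.
Proof.
move=> x dx y dy xd yd.
have [n_gt0 _ _ _ _ _ jacobi] := HL.
have xd' := homogeneous_tcast (addn_predr k m_gt0) (homogeneous_cat xd).
have := jacobi _ _ _ _ xd' (homogeneous_cat yd).
have -> : map_tuple alpha (xcat x) = xcat (map_tuple alpha x).
  apply: val_inj; rewrite /= !val_tcast.
  exact: (congr1 val (map_cat_fixed x)).
rewrite snoc_cat_tuple map_cat_fixed => jac; rewrite [LHS]jac {jac}.
(* Split the sum at [k]: a prefix summand has an inner bracket equal to 0, hence an outer bracket
   with a zero entry. *)
rewrite big_split_ord /= big1 ?add0r => [|i _]; last first.
  rewrite tnth_lshift snoc_cat_tuple -/(pbr _) (bracket_prefix_repetition _ xd).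
  by rewrite (multilinear_map0 _ _ (nhlc_multilinear HL)) scaler0.
apply: eq_bigr => i _.
rewrite tnth_rshift snoc_cat_tuple subst_cat_tuple sum_cat_degree.
congr (eps _ _ *: _); last by apply: eq_bigl => j; rewrite /= ltn_add2l.
(* It remains to compare the two total degrees X; reindexing along the cast between [k + m.-1] and
   [(k + m).-1] matches them. *)
rewrite -(sum_cat_degree dx predT).
rewrite (reindex _ (onW_bij _ (Bijective (cast_ordK (addn_predr k m_gt0))
  (cast_ordKV (addn_predr k m_gt0))))).
by apply: eq_bigr => j _; rewrite /= cast_ordK.
Qed.

Lemma partial_n_hom_Lie_color_algebra :
  n_hom_Lie_color_algebra V pbr eps alpha.
Proof.
apply: (NHomLieColorAlgebra (nhlc_arity_gt0 := m_gt0)).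
- exact: nhlc_grading HL.
- exact: partial_multilinear.
- exact: nhlc_bicharacter HL.
- exact: nhlc_even HL.
- exact: partial_skew.
- exact: partial_jacobi.
Qed.

End PartialBracket.

Theorem corollary3p2 (G : zmodType) (K : fieldType)
    (char_neq2 : 2%N \notin [pchar K]) (L : lmodType K) (V : G -> {pred L})
    (n k : nat) (n_ge2 : (2 <= n)%N) (k_ge1 : (1 <= k)%N) (lt_kn : (k < n)%N)
    (br : n.-tuple L -> L) (eps : G -> G -> K) (alpha : {linear L -> L})
    (HL : n_hom_Lie_color_algebra V br eps alpha)
    (xi : k.-tuple L) (xi_deg0 : forall i : 'I_k, tnth xi i \in V 0)
    (xi_fixed : forall i : 'I_k, alpha (tnth xi i) = tnth xi i) :
  n_hom_Lie_color_algebra V (partial_bracket (ltnW lt_kn) br xi) eps alpha.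
Proof.
rewrite /partial_bracket.
have : (0 < n - k)%N by rewrite subn_gt0.
(* Once [n - k] is an independent [m] with [e : k + m = n], eliminating [e] makes the [tcast] in the
   bracket trivial. *)
move: (n - k)%N (subnKC _) => m e m_gt0.
case: n / e {n_ge2 lt_kn} br HL => br HL.
exact: partial_n_hom_Lie_color_algebra.
Qed.
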